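(* For every $\varepsilon>0$ there exists $t_0$ such that for every integer $t\geq t_0$ there is a graph $G$ with no $K_t$-minor whose $(\frac32-\varepsilon)t$-colourings are not all Kempe equivalent.
   Context: All graphs are finite and simple, and all colourings are proper: a $k$-colouring of $G$ assigns to each vertex one of $k$ colours so that adjacent vertices receive different colours. Given a $k$-colouring $\alpha$ of $G$ and two colours $c_1,c_2$, a Kempe chain is a connected component of the subgraph of $G$ induced by the vertices coloured $c_1$ or $c_2$ (a vertex coloured $c_1$ with no neighbour coloured $c_2$ forms a Kempe chain by itself). A Kempe change swaps the two colours on one Kempe chain, yielding another $k$-colouring. Two $k$-colourings are Kempe equivalent if one can be obtained from the other by a finite sequence of Kempe changes. A graph $G$ has a $K_p$-minor if there are $p$ non-empty, pairwise disjoint vertex sets $B_1,\dots,B_p\subseteq V(G)$, each inducing a connected subgraph, such that for all $i\neq j$ there is an edge between a vertex of $B_i$ and a vertex of $B_j$. *)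

(* Defs.v *)
From HB Require Import structures.
From mathcomp Require Import all_boot all_order all_algebra all_fingroup.
From mathcomp Require Import reals.

Set Implicit Arguments.
Unset Strict Implicit.
Unset Printing Implicit Defensive.

Record sgraph := SGraph {
  vertex :> finType;
  adj : rel vertex;
  adj_sym : symmetric adj;
  adj_irrefl : irreflexive adj
}.

Section Defs.
Variable G : sgraph.

Definition induced_adj (A : {set G}) : rel G :=
  [rel x y | [&& x \in A, y \in A & adj x y]].

(* For x \in A, this is a subset of A: the vertex set of the connected
   component of x in G[A]. *)
Definition component (A : {set G}) (x : G) : {set G} :=
  [set y | connect (induced_adj A) x y].

Definition induces_connected (A : {set G}) : Prop :=
  A != set0 /\ {in A &, forall x y, connect (induced_adj A) x y}.

Definition has_complete_minor (p : nat) : Prop :=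
  exists B : 'I_p -> {set G},
    [/\ forall i, induces_connected (B i),
        forall i j, i != j -> [disjoint B i & B j]
      & forall i j, i != j ->
          exists x y, [/\ x \in B i, y \in B j & adj x y]].

Variable k : nat.
Implicit Types a b : {ffun G -> 'I_k}.

Definition proper_colouring a : bool :=
  [forall x, forall y, adj x y ==> (a x != a y)].

Definition bicoloured a (c1 c2 : 'I_k) : {set G} :=
  [set x | (a x == c1) || (a x == c2)].

Definition kempe_chain a (c1 c2 : 'I_k) (K : {set G}) : bool :=
  [exists x in bicoloured a c1 c2, K == component (bicoloured a c1 c2) x].

Definition swap_colours a (c1 c2 : 'I_k) (K : {set G}) : {ffun G -> 'I_k} :=
  [ffun x => if x \in K then tperm c1 c2 (a x) else a x].

Definition kempe_change a b : bool :=
  [exists c1 : 'I_k, exists c2 : 'I_k, exists K : {set G},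
     [&& c1 != c2, kempe_chain a c1 c2 K & b == swap_colours a c1 c2 K]].

(* Kempe changes preserve properness, so every colouring reached from a proper
   one is proper. *)
Definition kempe_equivalent a b : bool := connect kempe_change a b.

End Defs.

Definition all_colourings_kempe_equivalent (G : sgraph) (k : nat) : Prop :=
  forall a b : {ffun G -> 'I_k},
    proper_colouring a -> proper_colouring b -> kempe_equivalent a b.

(* Main.v *)
Require Import Defs.
From HB Require Import structures.
From mathcomp Require Import all_boot all_order all_algebra all_fingroup.
From mathcomp Require Import reals.
From mathcomp Require Import zify lra.

Set Implicit Arguments.
Unset Strict Implicit.
Unset Printing Implicit Defensive.

(** With [k] colours, the graph has [k] independent pairs of vertices, and
    between any two pairs three of the four possible edges, the missing one
    being chosen at random.  Colouring each pair with its own colour is frozen: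
    two colour classes induce a path on four vertices, so every Kempe change
    just permutes the colours.  Planting a triangular prism on the first three
    pairs provides a colouring with a different partition into classes.

    A [K_t]-minor with [3t] well above [2k] has linearly many branch sets of
    size at most 2, and a constant proportion of them, say [2m], use distinct
    pairs.  Two such sets are non-adjacent with probability at least [1/256],
    independently, so a union bound over [(2k)^(4m)] families against the
    probability [(255/256)^(m^2)] leaves a graph with no such minor. *)

(** * Functions deviating from a target on disjoint sets *)

Section Avoidance.
Variables (T : finType) (g : T -> bool).
Implicit Types (h : {ffun T -> bool}) (D : {set T}).

Definition deviates h D := [exists d in D, h d != g d].

Definition overwrite D h : {ffun T -> bool} :=
  [ffun d => if d \in D then g d else h d].

(* Overwriting [h] by [g] on [D], together with the subset of [D] where [h]
   differed from [g], determines [h]. *)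
Lemma card_deviates (A : {set {ffun T -> bool}}) D q :
  2 ^ #|D| <= q.+1 -> (forall h, h \in A -> overwrite D h \in A) ->
  #|[set h in A | deviates h D]| * q.+1 <= q * #|A|.
Proof.
move=> leDq closedA.
set N := [set h in A | deviates h D].
pose M := [set h in A | ~~ deviates h D].
have cardA : #|A| = #|N| + #|M|.
  rewrite -(cardsID [set h | deviates h D] A); congr (_ + _); apply: eq_card => h.
    by rewrite !inE.
  by rewrite !inE andbC.
have leA : #|A| <= #|M| * 2 ^ #|D|.
  rewrite -card_powerset -cardsX.
  pose code h := (overwrite D h, [set d in D | h d != g d]).
  rewrite -(@card_in_imset _ _ code A) => [|h1 h2 _ _ [e1 e2]].
    apply: subset_leq_card; apply/subsetP => _ /imsetP[h Ah ->].
    rewrite !inE closedA //=; apply/andP; split.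
      by apply/exists_inPn => d Dd; rewrite negbK ffunE Dd.
    by apply/subsetP => d; rewrite inE => /andP[].
  apply/ffunP => d; case Dd: (d \in D).
    by move/setP/(_ d): e2; rewrite !inE Dd /=; case: (h1 d) (h2 d) (g d) => [] [] [].
  by move/ffunP/(_ d): e1; rewrite !ffunE Dd.
have : #|A| <= #|M| * q.+1 by apply: leq_trans leA _; rewrite leq_mul2l leDq orbT.
by rewrite cardA; nia.
Qed.

(** Independence in counting form: overwriting on [D i] leaves the deviations on the other, disjoint
    sets intact, so [card_deviates] applies to the functions deviating on the tail of [r], and each
    index costs a factor [q / q.+1]. *)
Lemma card_all_deviate (I : eqType) (D : I -> {set T}) (r : seq I) q :
    (forall i, 2 ^ #|D i| <= q.+1) ->
    (forall i j, i != j -> [disjoint D i & D j]) -> uniq r ->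
  #|[set h | all (fun i => deviates h (D i)) r]| * q.+1 ^ size r
    <= q ^ size r * #|{ffun T -> bool}|.
Proof.
move=> leDq disjD; elim: r => [_|i r IHr /= /andP[inotr uniqr]].
  by rewrite muln1 mul1n max_card.
set A := [set h | all (fun j => deviates h (D j)) r] in IHr *.
have closedA h : h \in A -> overwrite (D i) h \in A.
  rewrite !inE => /allP devh; apply/allP => j jr.
  have /existsP[d /andP[Djd hd]] := devh j jr.
  apply/exists_inP; exists d => //; rewrite ffunE.
  have nij : j != i by apply: contraNneq inotr => <-.
  by rewrite (disjointFr (disjD _ _ nij) Djd).
have := card_deviates (leDq i) closedA.
have -> : [set h in A | deviates h (D i)]
        = [set h | deviates h (D i) && all (fun j => deviates h (D j)) r].
  by apply/setP => h; rewrite !inE andbC.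
move: (IHr uniqr); rewrite !expnS.
set a := #|A|; set b := #|[set _ | _]|; set t := #|{ffun _}|.
set x := q.+1 ^ _; set y := q ^ _ => H1 H2.
apply: (@leq_trans (q * a * x)); first by rewrite mulnA leq_mul2r H2 orbT.
by rewrite -!mulnA leq_mul2l H1 orbT.
Qed.

End Avoidance.

(** * Counting in disjoint families *)

Section DisjointFamily.
Variables (U I : finType) (B : I -> {set U}).
Hypothesis disjB : forall i j, i != j -> [disjoint B i & B j].

Lemma sum_card_disjoint : \sum_i #|B i| = #|\bigcup_i B i|.
Proof.
rewrite -sum1_card partition_disjoint_bigcup //.
by apply: eq_bigr => i _; rewrite sum1_card.
Qed.

Lemma card_transversal (A : {set U}) (Q : {set I}) :
  (forall i, i \in Q -> exists2 u, u \in B i & u \in A) -> #|Q| <= #|A|.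
Proof.
move=> hit; have [/eqP|/set0Pn[i0 Qi0]] := boolP (Q == set0).
  by move=> ->; rewrite cards0.
have [u0 _ _] := hit _ Qi0.
pose f i := odflt u0 [pick u in B i :&: A].
have fP i : i \in Q -> f i \in B i :&: A.
  move=> /hit[u uB uA]; rewrite /f; case: pickP => [v //|/(_ u)].
  by rewrite inE uB uA.
rewrite -(@card_in_imset _ _ f Q) => [|i j /fP fi /fP fj fij].
  by apply/subset_leq_card/subsetP => _ /imsetP[i /fP + ->] => /setIP[].
apply/eqP; apply: contraT => /disjB /disjointFr.
by case/setIP: fi => fi _ /(_ _ fi); rewrite fij; case/setIP: fj => ->.
Qed.

End DisjointFamily.

(** * The graph of pairs *)

Section Construction.
Variable n : nat.
Notation V := ('I_n * bool)%type.
Implicit Types (h : {ffun 'I_n * 'I_n -> bool}) (u v : V).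

(* The only non-edge between the pairs [i] and [j] joins [(i, h (i, j))] to
   [(j, h (j, i))]. *)
Definition gap h u v := (u.2 == h (u.1, v.1)) && (v.2 == h (v.1, u.1)).

Definition gap_adj h : rel V := fun u v => (u.1 != v.1) && ~~ gap h u v.

Lemma gap_adj_sym h : symmetric (gap_adj h).
Proof. by move=> u v; rewrite /gap_adj /gap eq_sym andbC [X in ~~ X]andbC andbC. Qed.

Lemma gap_adj_irrefl h : irreflexive (gap_adj h).
Proof. by move=> u; rewrite /gap_adj eqxx. Qed.

Definition gap_graph h := SGraph (gap_adj_sym h) (gap_adj_irrefl h).

(** * Union bound over families of small bags *)

Section Bags.
Variable m : nat.
Notation W := {ffun bool * 'I_m -> V * V}.
Implicit Type w : W.

(** A repeated entry encodes a one-vertex bag. *)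
Definition bag w z : {set V} := [set (w z).1; (w z).2].

(** The case [z = z'] matters too: no bag contains both vertices of a pair. *)
Definition separated w :=
  [forall z, forall z', forall u in bag w z, forall v in bag w z',
    (u.1 == v.1) ==> (z == z') && (u == v)].

(** Only bags with opposite Boolean labels are compared, which gives [m * m] events depending on
    disjoint sets of entries of [h]. *)
Definition joined h w :=
  [forall p : 'I_m * 'I_m, exists u in bag w (false, p.1),
    exists v in bag w (true, p.2), ~~ gap h u v].

Lemma separatedP w z z' u v : separated w ->
  u \in bag w z -> v \in bag w z' -> u.1 = v.1 -> z = z' /\ u = v.
Proof.
move=> /forallP/(_ z)/forallP/(_ z')/forall_inP/(_ u) sepw /sepw.
by move=> /forall_inP/(_ v) {}sepw /sepw /implyP {}sepw /eqP /sepw /andP[/eqP -> /eqP ->].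
Qed.

Lemma card_joined w : separated w ->
  #|[set h | joined h w]| * 256 ^ (m * m)
    <= 255 ^ (m * m) * #|{ffun 'I_n * 'I_n -> bool}|.
Proof.
move=> sepw.
(* [c i] is the side on which the family uses the pair [i]; two bags are
   non-adjacent exactly when [h (i, j) = c i] for all [i], [j] in distinct bags. *)
pose c (i : 'I_n) := [exists z, (i, true) \in bag w z].
have cE z u : u \in bag w z -> c u.1 = u.2.
  case: u => i [] /= uz; first by apply/existsP; exists z.
  apply/negbTE/existsP => -[z' uz'].
  by have [] := separatedP sepw uz uz' erefl.
pose J z := [set u.1 | u in bag w z].
have cardJ z : #|J z| <= 2.
  by apply: leq_trans (leq_imset_card _ _) _; rewrite /bag cards2; case: (_ != _).
have JP z z' i : i \in J z -> i \in J z' -> z = z'.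
  move=> /imsetP[u uz ->] /imsetP[v vz' e].
  by have [] := separatedP sepw uz vz' e.
(* At most 2 * 2 + 2 * 2 = 8 entries of [h] decide all gaps between the two bags, whence 256 = 2 ^
   8. *)
pose D (p : 'I_m * 'I_m) :=
  setX (J (false, p.1)) (J (true, p.2)) :|: setX (J (true, p.2)) (J (false, p.1)).
pose g (d : 'I_n * 'I_n) := c d.1.
have leD p : 2 ^ #|D p| <= 255.+1.
  rewrite (_ : 256 = 2 ^ 8) // leq_exp2l //.
  rewrite (leq_trans (leq_card_setU _ _)) // !cardsX.
  by have := (cardJ (false, p.1), cardJ (true, p.2)); case; nia.
have disjD p p' : p != p' -> [disjoint D p & D p'].
  move=> npp'; apply/pred0P => -[i j] /=; apply: contraNF npp'.
  rewrite !inE /= => /andP[/orP[]/andP[iz jz] /orP[]/andP[iz' jz']].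
  - have [e1] := JP _ _ _ iz iz'; have [e2] := JP _ _ _ jz jz'.
    by apply/eqP; case: (p) (p') e1 e2 => ? ? [? ?] /= -> ->.
  - by have := JP _ _ _ iz iz'.
  - by have := JP _ _ _ iz iz'.
  - have [e1] := JP _ _ _ iz iz'; have [e2] := JP _ _ _ jz jz'.
    by apply/eqP; case: (p) (p') e1 e2 => ? ? [? ?] /= -> ->.
have := card_all_deviate g leD disjD (enum_uniq {: 'I_m * 'I_m}).
rewrite -cardT card_prod card_ord; apply: leq_trans.
rewrite leq_mul2r; apply/orP; right; apply: subset_leq_card; apply/subsetP => h.
rewrite !inE => /forallP joinh; apply/allP => p _.
have /exists_inP[u uz /exists_inP[v vz]] := joinh p.
have uJ : u.1 \in J (false, p.1) by apply: imset_f.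
have vJ : v.1 \in J (true, p.2) by apply: imset_f.
have Du : (u.1, v.1) \in D p by rewrite in_setU !in_setX uJ vJ.
have Dv : (v.1, u.1) \in D p by rewrite in_setU !in_setX uJ vJ orbT.
rewrite /gap negb_and => /orP[] ne; apply/exists_inP.
  by exists (u.1, v.1) => //; rewrite /g /= (cE _ _ uz) eq_sym.
by exists (v.1, u.1) => //; rewrite /g /= (cE _ _ vz) eq_sym.
Qed.

Lemma exists_unjoined :
  (n.*2 ^ 4 * 255 ^ m) ^ m < 256 ^ (m * m) ->
  exists h, forall w, separated w -> ~~ joined h w.
Proof.
move=> lt_pow.
pose N := #|{ffun 'I_n * 'I_n -> bool}|.
have N_gt0 : 0 < N by rewrite /N card_ffun expn_gt0 card_bool.
pose bad := \bigcup_(w | separated w) [set h | joined h w].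
have le_bad : #|bad| * 256 ^ (m * m) <= (n.*2 ^ 4 * 255 ^ m) ^ m * N.
  have cardW : #|{: W}| = (n.*2 ^ 4) ^ m.
    rewrite card_ffun !card_prod card_bool !card_ord muln2 mulnn -!expnM.
    by congr (_ ^ _); lia.
  rewrite expnMn -cardW -expnM -mulnA -[leqRHS]sum_nat_const.
  apply: (@leq_trans ((\sum_(w | separated w) #|[set h | joined h w]|) * 256 ^ (m * m))).
    rewrite leq_mul2r; apply/orP; right.
    apply: (big_ind2 (fun (A : {set _}) a => #|A| <= a)) => [|A a B b leA leB|//].
      by rewrite cards0.
    by apply: leq_trans (leq_card_setU _ _) _; apply: leq_add.
  rewrite big_distrl /= big_mkcond /=; apply: leq_sum => w _.
  by case: ifP => // /card_joined.
have [h hbad] : exists h, h \notin bad.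
  apply/existsP; rewrite -negb_forall; apply/negP => /forallP allbad.
  have badN : #|bad| = N by apply: eq_card => h; rewrite allbad inE.
  by move: le_bad; rewrite badN mulnC leq_pmul2r // leqNgt lt_pow.
exists h => w sepw; apply: contra hbad => joinhw.
by apply/bigcupP; exists w => //; rewrite inE.
Qed.

End Bags.

(* On the index classes [0], [1], [2] the missing edges complete the three
   non-adjacent pairs to a 6-cycle of non-edges, so these classes induce a
   triangular prism. *)
Definition plant h : {ffun 'I_n * 'I_n -> bool} :=
  [ffun d : 'I_n * 'I_n => if (d.1 < 3) && (d.2 < 3) then d.1.+1 %% 3 == d.2 else h d].

(** * Complete minors yield joined families *)

Lemma small_bag h (B : {set gap_graph h}) :
  induces_connected (B) -> #|B| <= 2 ->
  exists q : V * V, B = [set q.1; q.2] /\ (q.1.1 = q.2.1 -> q.1 = q.2).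
Proof.
case=> nzB conB; rewrite leq_eqVlt => /orP[/cards2P[u [v [nuv BE]]]|].
  exists (u, v); split=> //= euv.
  have uB : u \in B by rewrite BE !inE eqxx.
  have vB : v \in B by rewrite BE !inE eqxx orbT.
  have /connectP[[|y s] /=] := conB u v uB vB; first by move=> _ ->.
  move=> /andP[/and3P[_ yB uy] _] _; move: yB uy; rewrite BE !inE.
  by case/orP=> /eqP ->; rewrite /= /gap_adj ?euv eqxx.
rewrite ltnS leq_eqVlt ltnS leqn0 cards_eq0 (negbTE nzB) orbF => /cards1P[u BE].
by exists (u, u); rewrite /= setUid.
Qed.

Lemma no_complete_minor h m t :
    (forall w : {ffun bool * 'I_m -> V * V}, separated w -> ~~ joined h w) ->
    n.*2 + 16 * m + 4 < 3 * t ->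
  ~ has_complete_minor (gap_graph (plant h)) t.
Proof.
move=> unjoined lt_t [B [conB disjB adjB]].
have nzB i : exists u, u \in B i by case: (conB i) => /set0Pn.
pose Q := [set i | #|B i| <= 2].
(* A branch set of size b satisfies 3 <= b, or 3 <= b + 2 when it is small; sum over all branch
   sets. *)
have cardQ : 3 * t <= n.*2 + 2 * #|Q|.
  have sumB : \sum_i #|B i| <= n.*2.
    have <- : #|{: V}| = n.*2 by rewrite card_prod card_ord card_bool muln2.
    by rewrite sum_card_disjoint // max_card.
  have -> : 3 * t = \sum_(i < t) 3 by rewrite sum_nat_const card_ord mulnC.
  rewrite -sum1_card big_distrr /= [in leqRHS]big_mkcond /=.
  apply: leq_trans (leq_add sumB (leqnn _)); rewrite -big_split /=.
  apply: leq_sum => i _; rewrite inE.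
  have Bi_gt0 : 0 < #|B i| by rewrite card_gt0; case: (conB i).
  by move: #|B i| Bi_gt0 => b; case: (leqP b 2); lia.
(* Small branch sets that avoid the planted indices and share no index with one another; a largest
   such family [I] is taken. *)
pose far (I : {set 'I_t}) := [&& I \subset Q,
  [forall i in I, forall u in B i, 3 <= u.1] &
  [forall i in I, forall j in I, forall u in B i, forall v in B j,
     (u.1 == v.1) ==> (i == j)]].
have far0 : far set0.
  by rewrite /far sub0set /=; apply/andP; split; apply/forall_inP => i; rewrite inE.
case: (arg_maxnP (fun I : {set 'I_t} => #|I|) far0) => I /and3P[/subsetP IQ I3 Isep] Imax.
have {}I3 i u : i \in I -> u \in B i -> 3 <= u.1.
  by move=> Ii; move: u; apply/forall_inP; move: i Ii; apply/forall_inP.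
have {}Isep i j u v : i \in I -> j \in I -> u \in B i -> v \in B j -> u.1 = v.1 -> i = j.
  move=> Ii Ij ui vj /eqP uv; apply/eqP.
  move/forall_inP/(_ i Ii)/forall_inP/(_ j Ij): Isep.
  by move=> /forall_inP/(_ u ui)/forall_inP/(_ v vj)/implyP/(_ uv).
(* By maximality every small branch set meets an index in [U]. These at most 3 + 2 * #|I| indices
   carry two vertices each, so #|Q| <= 6 + 4 * #|I|, while #|Q| > 8 * m + 2. *)
have cardI : 2 * m <= #|I|.
  pose U := [set x : 'I_n | x < 3] :|: [set u.1 | u in \bigcup_(i in I) B i].
  have IU i u : i \in I -> u \in B i -> u.1 \in U.
    by move=> Ii ui; rewrite inE imset_f ?orbT //; apply/bigcupP; exists i.
  have cardU : #|U| <= 3 + 2 * #|I|.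
    apply: leq_trans (leq_card_setU _ _) (leq_add _ _).
      rewrite -(@card_in_imset _ _ (fun x : 'I_n => inord x : 'I_3)).
        by rewrite -[X in _ <= X]card_ord max_card.
      move=> x y; rewrite !inE => x3 y3 /(congr1 val) /=.
      by rewrite !inordK // => /val_inj.
    apply: leq_trans (leq_imset_card _ _) _.
    rewrite mulnC -sum_nat_const.
    apply: (big_rec2 (fun (A : {set _}) a => #|A| <= a)) => [|i a A Ii leA].
      by rewrite cards0.
    apply: leq_trans (leq_card_setU _ _) (leq_add _ leA).
    by have := IQ i Ii; rewrite inE.
  have : #|Q| <= #|[set u : V | u.1 \in U]|.
    apply: (card_transversal disjB) => i Qi; apply/exists_inP; apply: contraT.
    move=> /exists_inPn avoidU.
    have {}avoidU u : u \in B i -> u.1 \notin U.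
      by move=> /avoidU; rewrite inE.
    suff /Imax : far (i |: I).
      rewrite cardsU1; case Ii: (i \in I); last by rewrite /= add1n ltnn.
      by have [u ui] := nzB i; have := IU _ _ Ii ui; rewrite (negbTE (avoidU u ui)).
    apply/and3P; split.
    - by apply/subsetP => j /setU1P[->|/IQ].
    - apply/forall_inP => j /setU1P[->|Ij]; apply/forall_inP => u uj; last exact: I3 uj.
      by have := avoidU u uj; rewrite !inE negb_or -leqNgt => /andP[].
    apply/forall_inP => j jI; apply/forall_inP => k kI; apply/forall_inP => u uj.
    apply/forall_inP => v vk; apply/implyP => /eqP uv; apply/eqP.
    case/setU1P: jI uj => [->|Ij] uj; case/setU1P: kI vk => [->|Ik] vk //.
    - by have := avoidU u uj; rewrite uv (IU _ _ Ik vk).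
    - by have := avoidU v vk; rewrite -uv (IU _ _ Ij uj).
    - exact: Isep uj vk uv.
  have -> : [set u : V | u.1 \in U] = setX U setT.
    by apply/setP => u; rewrite !inE andbT.
  by rewrite cardsX cardsT card_bool; lia.
have leI : #|{: bool * 'I_m}| <= #|I| by rewrite card_prod card_bool card_ord.
pose e (z : bool * 'I_m) : 'I_t := enum_val (widen_ord leI (enum_rank z)).
have eI z : e z \in I by apply: enum_valP.
have e_inj : injective e.
  by move=> z z' /enum_val_inj /(congr1 val) /= /ord_inj /enum_rank_inj.
have /fin_all_exists[q qP] (z : bool * 'I_m) : exists q : V * V,
    B (e z) = [set q.1; q.2] /\ (q.1.1 = q.2.1 -> q.1 = q.2).
  by apply: small_bag => //; have := IQ _ (eI z); rewrite inE.
pose w := [ffun z => q z].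
have bagE z : bag w z = B (e z) by rewrite /bag ffunE; case: (qP z).
suff : joined h w.
  apply/negP/unjoined; apply/forallP => z; apply/forallP => z'; rewrite !bagE.
  apply/forall_inP => u uz; apply/forall_inP => v vz; apply/implyP => /eqP uv.
  have /e_inj zz := Isep _ _ _ _ (eI _) (eI _) uz vz uv; rewrite -{}zz in vz *.
  rewrite eqxx /=; have [Bz qz] := qP z; move: uz vz uv; rewrite Bz.
  case/set2P=> -> /set2P[] -> //; first by move/qz ->.
  by move/esym/qz ->.
apply/forallP => p; rewrite !bagE.
have [|u [v [uB vB /andP[_ ngap]]]] := adjB (e (false, p.1)) (e (true, p.2)).
  by apply/eqP => /e_inj.
apply/exists_inP; exists u => //; apply/exists_inP; exists v => //.
(* All indices involved are at least 3, where [plant h] agrees with [h]. *)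
move: ngap; rewrite /gap !ffunE /=.
by rewrite !(ltnNge _ 3) (I3 _ _ (eI _) uB) (I3 _ _ (eI _) vB).
Qed.

End Construction.

Section Colourings.
Variables (n : nat) (h : {ffun 'I_n * 'I_n -> bool}).
Notation G := (gap_graph h).
Implicit Types (a b : {ffun G -> 'I_n}) (s : {perm 'I_n}).

Lemma frozen_component a s (c1 c2 : 'I_n) (x : G) :
    (forall u, a u = s u.1) -> c1 != c2 -> x \in bicoloured a c1 c2 ->
  component (bicoloured a c1 c2) x = bicoloured a c1 c2.
Proof.
move=> aE nc xA; set A := bicoloured a c1 c2 in xA *.
pose i := (s^-1)%g c1; pose j := (s^-1)%g c2.
have nij : i != j by rewrite (inj_eq perm_inj).
have AE (u : G) : (u \in A) = (u.1 == i) || (u.1 == j).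
  by rewrite inE !aE -(inj_eq (@perm_inj _ s) u.1 i) -(inj_eq (@perm_inj _ s) u.1 j) !permKV.
have symA : connect_sym (induced_adj A).
  by apply: sym_connect_sym => u v; rewrite /induced_adj /= gap_adj_sym andbCA.
(* The vertex of pair [i] that misses the non-edge: it is adjacent to both vertices of pair [j]. Its
   partner is reached through the corresponding vertex of pair [j]. *)
pose r : G := (i, ~~ h (i, j)).
have rj y : connect (induced_adj A) r ((j, y) : G).
  apply: connect1; rewrite /induced_adj /= !AE /= !eqxx orbT /= /gap_adj /gap nij /=.
  by case: (h (i, j)).
have ri y : connect (induced_adj A) r ((i, y) : G).
  apply: connect_trans (rj (~~ h (j, i))) _; apply: connect1.
  rewrite /induced_adj /= !AE /= !eqxx orbT /= /gap_adj /gap eq_sym nij /=.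
  by case: (h (j, i)).
have conA u : u \in A -> connect (induced_adj A) r u.
  by rewrite AE; case: u => k y /= /orP[]/eqP ->.
apply/setP => y; rewrite inE; apply/idP/idP => [/connectP[p]|yA].
  elim: p x xA => [|z p IHp] x xA /=; first by move=> _ ->.
  by move=> /andP[/and3P[_ zA _]] /(IHp z zA).
by apply: connect_trans (conA y yA); rewrite symA conA.
Qed.

Lemma frozen_kempe_change a b :
  (exists s, forall u, a u = s u.1) -> kempe_change a b ->
  exists s, forall u, b u = s u.1.
Proof.
move=> [s aE] /existsP[c1 /existsP[c2 /existsP[K /and3P[nc]]]].
move=> /exists_inP[x xA /eqP ->] /eqP ->.
exists (s * tperm c1 c2)%g => u; rewrite ffunE (frozen_component aE nc xA) permM -aE.
case: ifP => //; rewrite inE => /norP[].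
by rewrite ![a u == _]eq_sym => n1 n2; rewrite tpermD.
Qed.

Lemma frozen_kempe_equivalent a b :
  (exists s, forall u, a u = s u.1) -> kempe_equivalent a b ->
  exists s, forall u, b u = s u.1.
Proof.
move=> + /connectP[p]; elim: p a => [|c p IHp] a aE /=; first by move=> _ ->.
by move=> /andP[/(frozen_kempe_change aE) cE pth]; apply: IHp.
Qed.

End Colourings.

(** * A second colouring, from the planted prism *)

Section PrismColouring.
Variables (n : nat) (h : {ffun 'I_n * 'I_n -> bool}).
Hypothesis n_ge3 : 3 <= n.

(** The 3-cycle on 0, 1, 2, fixing all other indices. The default of [insubd] is never reached,
    since [n_ge3] keeps the value below [n]. *)
Definition rotate3 (i : 'I_n) : 'I_n := insubd i (if i < 3 then i.+1 %% 3 else i).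

Lemma val_rotate3 i : rotate3 i = (if i < 3 then i.+1 %% 3 else i) :> nat.
Proof.
rewrite val_insubd; case: (ltnP i 3) => _; last by rewrite ltn_ord.
by rewrite (leq_trans _ n_ge3) // ltn_pmod.
Qed.

Lemma rotate3_inj : injective rotate3.
Proof.
move=> i j /(congr1 val) /=; rewrite !val_rotate3 => eij; apply: val_inj => /=.
by move: eij; case: (ltnP i 3); case: (ltnP j 3); lia.
Qed.

Lemma gap_rotate3 i : rotate3 i != i ->
  gap (plant h) (i, true) (rotate3 i, false).
Proof.
rewrite -val_eqE /= /gap !ffunE /= !val_rotate3.
case: (ltnP i 3) => [i3 _|]; last by rewrite eqxx.
by rewrite ltn_pmod //= eqxx /=; apply/eqP/esym/negbTE; lia.
Qed.

(** On the planted indices the colour classes are the non-edges between (i, true) and (i + 1 mod 3,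
    false) instead of the pairs. *)
Definition prism_colouring : {ffun gap_graph (plant h) -> 'I_n} :=
  [ffun u => if u.2 then rotate3 u.1 else u.1].

Lemma prism_colouring_proper : proper_colouring prism_colouring.
Proof.
apply/forallP => -[i x]; apply/forallP => -[j y]; apply/implyP => /andP[/= nij].
apply: contraNneq; rewrite !ffunE /=.
case: x y => [] [] /= eij.
- by rewrite (rotate3_inj eij) eqxx in nij.
- by rewrite -eij gap_rotate3 // eij eq_sym.
- by rewrite /gap andbC -/(gap _ (j, true) (i, false)) eij gap_rotate3 // -eij.
- by rewrite eij eqxx in nij.
Qed.

Lemma not_all_kempe_equivalent : ~ all_colourings_kempe_equivalent (gap_graph (plant h)) n.
Proof.
move=> allK; pose a : {ffun gap_graph (plant h) -> 'I_n} := [ffun u => u.1].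
have a_proper : proper_colouring a.
  by apply/forallP => u; apply/forallP => v; rewrite !ffunE; apply/implyP => /andP[].
have aE : exists s : {perm 'I_n}, forall u, a u = s u.1.
  by exists 1%g => u; rewrite ffunE perm1.
have [s sE] := frozen_kempe_equivalent aE (allK _ _ a_proper prism_colouring_proper).
(* A permuted frozen colouring is constant on pair 0, but the prism colouring gives its vertices
   colours 1 and 0. *)
pose i0 := Ordinal (leq_trans (isT : 0 < 3) n_ge3).
have := sE (i0, true); rewrite -(sE (i0, false)) !ffunE /= => /(congr1 val) /=.
by rewrite val_rotate3.
Qed.

End PrismColouring.

(** * Exponential against quartic growth *)

(** Bernoulli's inequality for (1 + 1/q)^j, cleared of denominators. *)
Lemma bernoulli_nat q j : (q + j) * q ^ j <= q * q.+1 ^ j.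
Proof.
elim: j => [|j IHj]; first by rewrite addn0.
rewrite !expnS; move: (q ^ j) (q.+1 ^ j) IHj => x y; nia.
Qed.

(** Cutting [m] into five blocks of length [j] and applying Bernoulli to each gives growth of degree
    5 in [j], which beats the quartic once [q + j] exceeds the constant [K]. *)
Lemma quartic_lt_exponential C q : 0 < q ->
  exists M, forall m, M <= m -> (C * m.+1) ^ 4 * q ^ m < q.+1 ^ m.
Proof.
move=> q_gt0; pose K := (5 * C) ^ 4 * q ^ 5; exists (5 * K.+1) => m leKm.
pose j := m %/ 5; have ltKj : K < q + j by lia.
have lin : (C * m.+1) ^ 4 <= (5 * C) ^ 4 * (q + j) ^ 4.
  by rewrite -expnMn leq_exp2r // (mulnC 5) -mulnA leq_mul2l; apply/orP; right; lia.
have growth : (q + j) ^ 5 * q ^ m <= q ^ 5 * q.+1 ^ m.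
  have -> : m = j * 5 + m %% 5 := divn_eq m 5.
  rewrite !expnD !(expnM _ j) (mulnA _ ((q ^ j) ^ 5)) (mulnA _ ((q.+1 ^ j) ^ 5)).
  rewrite -!(expnMn _ _ 5) leq_mul //.
    by rewrite leq_exp2r // bernoulli_nat.
  by case: (m %% 5) => // r; rewrite leq_exp2r.
rewrite -(@ltn_pmul2l (q ^ 5)) ?expn_gt0 ?q_gt0 //.
apply: leq_trans growth; rewrite mulnA ltn_pmul2r ?expn_gt0 ?q_gt0 //.
rewrite (expnS _ 4); apply: (@leq_ltn_trans (K * (q + j) ^ 4)).
  by rewrite /K [leqRHS]mulnAC [leqRHS]mulnC leq_mul2l lin orbT.
by rewrite ltn_pmul2r // expn_gt0; apply/orP; left; lia.
Qed.

(** * Choice of parameters *)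

Import Order.TTheory GRing.Theory Num.Theory.
Local Open Scope ring_scope.

Theorem theorem1 (R : realType) (eps : R) (eps_gt0 : 0 < eps)
    (eps_lt : eps < 3 / 2) :
  exists t0 : nat, forall t : nat, (t0 <= t)%N ->
    exists G : sgraph,
      ~ has_complete_minor G t /\
      ~ all_colourings_kempe_equivalent G (Num.truncn ((3 / 2 - eps) * t%:R)).
Proof.
have slack_gt0 : 0 < 3 / 2 - eps by rewrite subr_gt0.
have [L L_eps] : exists L : nat, 1 <= L%:R * eps.
  exists (Num.truncn eps^-1).+1; rewrite -ler_pdivrMr // div1r.
  exact/ltW/truncnS_gt.
have [L' L'_eps] : exists L' : nat, 3 <= L'%:R * (3 / 2 - eps).
  exists (Num.truncn (3 / (3 / 2 - eps))).+1; rewrite -ler_pdivrMr //.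
  exact/ltW/truncnS_gt.
have L_gt0 : (0 < L)%N by case: L L_eps => //; rewrite mul0r; lra.
(* The constant comes from 2k <= 3t < 48 * L * (m + 1), with [k] and [m] as chosen below. *)
have [M MP] := quartic_lt_exponential (48 * L) (isT : 0 < 255)%N.
exists (maxn (16 * L * M.+1) L')%N => t.
rewrite geq_max => /andP[le_t leL't].
set k := Num.truncn _.
have k_ge3 : (3 <= k)%N.
  rewrite truncn_gt_nat (le_trans L'_eps) // mulrC ler_wpM2l ?ler_nat //.
  exact: ltW.
have k_le : (2 * t + 2 * k * L <= 3 * t * L)%N.
  have kx : k%:R <= (3 / 2 - eps) * t%:R.
    by rewrite truncn_le mulr_ge0 // ltW.
  have := (ler_wpM2r (ler0n R t) L_eps, ler_wpM2r (ler0n R L) kx).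
  by case=> h1 h2; rewrite -(ler_nat R) !natrD !natrM; lra.
(* The slack 3t - 2k is at least 2t / L: one t / L pays for 16 * m, and the other exceeds 4 because
   t >= 16 * L. *)
pose m := (t %/ (16 * L))%N.
have leMm : (M <= m)%N by rewrite leq_divRL ?muln_gt0 //; nia.
have m_gt0 : (0 < m)%N by rewrite divn_gt0 ?muln_gt0 //; nia.
have lem : (m * (16 * L) <= t)%N by apply: leq_trunc_div.
have ltm : (t < m.+1 * (16 * L))%N by rewrite ltn_ceil // muln_gt0.
have [|h hP] := @exists_unjoined k m.
  rewrite expnM ltn_exp2r //; apply: leq_ltn_trans (MP m leMm).
  by rewrite leq_mul2r leq_exp2r //; apply/orP; right; nia.
exists (gap_graph (plant h)); split; last exact: not_all_kempe_equivalent.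
by apply: no_complete_minor hP _; rewrite -(ltn_pmul2r L_gt0); nia.
Qed.
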